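(* Let $E$ be an arbitrary directed graph and $K$ any field. If $E$ contains cycles and the Leavitt path algebra $L_K(E)$ is CIRT, then the field $K$ must be countable (i.e. finite or countably infinite).
   Context: A directed graph $E=(E^0,E^1,r,s)$ consists of a set $E^0$ of vertices, a set $E^1$ of edges and maps $r,s:E^1\to E^0$ (range and source); there are no restrictions on the cardinalities of $E^0$, $E^1$ or of the sets $s^{-1}(v)$. A vertex $v$ is regular if $0<|s^{-1}(v)|<\infty$. Given a field $K$, the Leavitt path algebra $L_K(E)$ is the (not necessarily unital) $K$-algebra generated by pairwise orthogonal idempotents $\{v:v\in E^0\}$ and elements $\{e,e^*:e\in E^1\}$ subject to: (1) $s(e)e=e=er(e)$; (2) $r(e)e^*=e^*=e^*s(e)$; (3) $e^*e=r(e)$ and $e^*f=0$ for edges $e\ne f$; (4) $v=\sum_{e\in E^1,\,s(e)=v}ee^*$ for every regular vertex $v$. $L_K(E)$ is called CIRT (of countable irreducible representation type) if it has at most countably many distinct isomorphism classes of simple left (equivalently, by the standard involution of $L_K(E)$, simple right) $L_K(E)$-modules. A left module $S$ over a ring $R$ (not necessarily unital) is simple if $RS\neq 0$ and $S$ has no submodules other than $0$ and $S$; similarly for right modules. A path $e_1\cdots e_n$ ($n\ge 1$, $r(e_i)=s(e_{i+1})$) is closed if $r(e_n)=s(e_1)$, and a closed path is a cycle if $s(e_i)\neq s(e_j)$ for all $i\neq j$. *)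

(* Defs.v *)
From Stdlib Require List.
From HB Require Import structures.
From mathcomp Require Import all_boot all_algebra generic_quotient.
From mathcomp Require Import boolp classical_sets cardinality.

Set Implicit Arguments.
Unset Strict Implicit.
Unset Printing Implicit Defensive.

Import GRing.Theory.

Local Open Scope ring_scope.
Local Open Scope quotient_scope.
Local Open Scope classical_set_scope.

(* MathComp's rings are unital, whereas L_K(E) is unital only when E^0 is
   finite; hence these two structures. *)

HB.mixin Record Zmodule_isRng R of GRing.Zmodule R := {
  rmul : R -> R -> R;
  rmulA : associative rmul;
  rmulDl : left_distributive rmul +%R;
  rmulDr : right_distributive rmul +%R
}.

#[short(type="rngType")]
HB.structure Definition Rng := {R of GRing.Zmodule R & Zmodule_isRng R}.

HB.mixin Record isNonUnitalAlgebra (K : pzRingType) A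
    of Rng A & GRing.Lmodule K A := {
  scale_rmull : forall (k : K) (x y : A), k *: rmul x y = rmul (k *: x) y;
  scale_rmulr : forall (k : K) (x y : A), k *: rmul x y = rmul x (k *: y)
}.

#[short(type="nualgType")]
HB.structure Definition NonUnitalAlgebra (K : pzRingType) :=
  {A of Rng A & GRing.Lmodule K A & isNonUnitalAlgebra K A}.

Infix "**" := rmul (at level 40, left associativity).

Record leftModule (R : rngType) := LeftModule {
  carrier :> zmodType;
  act : R -> carrier -> carrier;
  act_addr : forall r x y, act r (x + y) = act r x + act r y;
  act_addl : forall r s x, act (r + s) x = act r x + act s x;
  act_mul : forall r s x, act (r ** s) x = act r (act s x)
}.

Definition is_submodule (R : rngType) (S : leftModule R) (N : set S) : Prop :=
  [/\ N 0,
      forall x y, N x -> N y -> N (x + y),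
      forall x, N x -> N (- x)
    & forall r x, N x -> N (act r x)].

(* The first conjunct is RS <> 0. *)
Definition is_simple (R : rngType) (S : leftModule R) : Prop :=
  (exists (r : R) (x : S), act r x <> 0) /\
  (forall N : set S, is_submodule N -> N = [set 0] \/ N = setT).

Definition module_iso (R : rngType) (S T : leftModule R) : Prop :=
  exists f : {additive S -> T},
    bijective f /\ forall (r : R) (x : S), f (act r x) = act r (f x).

(* An injection of the isomorphism classes of simple modules into nat, given
   by a function on modules that is constant on these classes: a set of
   classes would have type set (leftModule R), which set's universe excludes. *)
Definition CIRT (R : rngType) : Prop :=
  exists f : leftModule R -> nat, forall S T : leftModule R,
    is_simple S -> is_simple T -> (f S = f T <-> module_iso S T).

Record digraph := Digraph {
  vertex : Type;
  edge : Type;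
  range : edge -> vertex;
  source : edge -> vertex
}.

Definition emitted (E : digraph) (v : vertex E) : set (edge E) :=
  [set e | source e = v].

Definition regular (E : digraph) (v : vertex E) : Prop :=
  emitted v !=set0 /\ finite_set (emitted v).

Definition composable (E : digraph) (e f : edge E) : bool :=
  `[< range e = source f >].

(* A nonempty sequence of edges; [cycle] also imposes the condition
   r(e_n) = s(e_1). *)
Definition closed_path (E : digraph) (p : seq (edge E)) : Prop :=
  p <> [::] /\ path.cycle (@composable E) p.

Definition is_cycle (E : digraph) (p : seq (edge E)) : Prop :=
  closed_path p /\ pairwise (fun e f => `[< source e <> source f >]) p.

Definition enumerates (E : digraph) (v : vertex E) (es : seq (edge E)) : Prop :=
  List.NoDup es /\ forall e, List.In e es <-> emitted v e.

(* The Leavitt path algebra is the quotient of the algebra terms on the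
   generators v, e, e^* by the least congruence containing the axioms of
   (not necessarily unital) K-algebras and the Leavitt relations. *)

Section LeavittPathAlgebra.
Variables (K : fieldType) (E : digraph).

Inductive term : Type :=
| Vertex of vertex E
| Edge of edge E
| Ghost of edge E
| Zero
| Opp of term
| Add of term & term
| Scale of K & term
| Mul of term & term.

Inductive lpa_eq : term -> term -> Prop :=
| Lrefl x : lpa_eq x x
| Lsym x y : lpa_eq x y -> lpa_eq y x
| Ltrans x y z : lpa_eq x y -> lpa_eq y z -> lpa_eq x z
| LOpp x x' : lpa_eq x x' -> lpa_eq (Opp x) (Opp x')
| LAdd x x' y y' :
    lpa_eq x x' -> lpa_eq y y' -> lpa_eq (Add x y) (Add x' y')
| LScale k x x' : lpa_eq x x' -> lpa_eq (Scale k x) (Scale k x')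
| LMul x x' y y' :
    lpa_eq x x' -> lpa_eq y y' -> lpa_eq (Mul x y) (Mul x' y')
| LaddA x y z : lpa_eq (Add x (Add y z)) (Add (Add x y) z)
| LaddC x y : lpa_eq (Add x y) (Add y x)
| Ladd0 x : lpa_eq (Add Zero x) x
| LaddN x : lpa_eq (Add (Opp x) x) Zero
| LscaleA a b x : lpa_eq (Scale a (Scale b x)) (Scale (a * b) x)
| Lscale1 x : lpa_eq (Scale 1 x) x
| LscaleDr a x y : lpa_eq (Scale a (Add x y)) (Add (Scale a x) (Scale a y))
| LscaleDl a b x : lpa_eq (Scale (a + b) x) (Add (Scale a x) (Scale b x))
| LmulA x y z : lpa_eq (Mul x (Mul y z)) (Mul (Mul x y) z)
| LmulDl x y z : lpa_eq (Mul (Add x y) z) (Add (Mul x z) (Mul y z))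
| LmulDr x y z : lpa_eq (Mul x (Add y z)) (Add (Mul x y) (Mul x z))
| LscaleMl a x y : lpa_eq (Scale a (Mul x y)) (Mul (Scale a x) y)
| LscaleMr a x y : lpa_eq (Scale a (Mul x y)) (Mul x (Scale a y))
| Lidem v : lpa_eq (Mul (Vertex v) (Vertex v)) (Vertex v)
| Lorth v w : v <> w -> lpa_eq (Mul (Vertex v) (Vertex w)) Zero
| Lsource e : lpa_eq (Mul (Vertex (source e)) (Edge e)) (Edge e)
| Lrange e : lpa_eq (Mul (Edge e) (Vertex (range e))) (Edge e)
| LrangeG e : lpa_eq (Mul (Vertex (range e)) (Ghost e)) (Ghost e)
| LsourceG e : lpa_eq (Mul (Ghost e) (Vertex (source e))) (Ghost e)
| LCK1 e : lpa_eq (Mul (Ghost e) (Edge e)) (Vertex (range e))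
| LCK1o e f : e <> f -> lpa_eq (Mul (Ghost e) (Edge f)) Zero
| LCK2 v es : regular v -> enumerates v es ->
    lpa_eq (Vertex v) (\big[Add/Zero]_(e <- es) Mul (Edge e) (Ghost e)).

HB.instance Definition _ := gen_eqMixin term.
HB.instance Definition _ := gen_choiceMixin term.

Definition lpa_eqb (x y : term) : bool := `[< lpa_eq x y >].

Lemma lpa_eqb_refl : reflexive lpa_eqb.
Proof. by move=> x; apply/asboolP; exact: Lrefl. Qed.

Lemma lpa_eqb_sym : symmetric lpa_eqb.
Proof. by move=> x y; apply/asboolP/asboolP => h; exact: Lsym. Qed.

Lemma lpa_eqb_trans : transitive lpa_eqb.
Proof.
move=> y x z /asboolP xy /asboolP yz; apply/asboolP; exact: Ltrans xy yz.
Qed.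

Canonical lpa_equiv := EquivRel lpa_eqb lpa_eqb_refl lpa_eqb_sym lpa_eqb_trans.

Definition lpa : Type := {eq_quot lpa_equiv}.

HB.instance Definition _ := Choice.on lpa.
HB.instance Definition _ := EqQuotient.on lpa.

Definition cls (x : term) : lpa := \pi_lpa x.

Lemma clsP x y : cls x = cls y <-> lpa_eq x y.
Proof.
split=> [/eqP|h]; first by rewrite eqmodE => /asboolP.
by apply/eqP; rewrite eqmodE; apply/asboolP.
Qed.

Lemma cls_repr (a : lpa) : cls (repr a) = a.
Proof. exact: reprK. Qed.

Lemma repr_cls x : lpa_eq (repr (cls x)) x.
Proof. by apply/clsP; rewrite cls_repr. Qed.

Definition lpa_opp (a : lpa) : lpa := cls (Opp (repr a)).
Definition lpa_add (a b : lpa) : lpa := cls (Add (repr a) (repr b)).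
Definition lpa_scale (k : K) (a : lpa) : lpa := cls (Scale k (repr a)).
Definition lpa_mul (a b : lpa) : lpa := cls (Mul (repr a) (repr b)).

Lemma lpa_oppE x : lpa_opp (cls x) = cls (Opp x).
Proof. by apply/clsP/LOpp/repr_cls. Qed.

Lemma lpa_addE x y : lpa_add (cls x) (cls y) = cls (Add x y).
Proof. by apply/clsP; apply: LAdd; exact: repr_cls. Qed.

Lemma lpa_scaleE k x : lpa_scale k (cls x) = cls (Scale k x).
Proof. by apply/clsP/LScale/repr_cls. Qed.

Lemma lpa_mulE x y : lpa_mul (cls x) (cls y) = cls (Mul x y).
Proof. by apply/clsP; apply: LMul; exact: repr_cls. Qed.

Let lpaE := (lpa_oppE, lpa_addE, lpa_scaleE, lpa_mulE).

Lemma lpa_addA : associative lpa_add.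
Proof.
move=> a b c; rewrite -(cls_repr a) -(cls_repr b) -(cls_repr c) !lpaE.
exact/clsP/LaddA.
Qed.

Lemma lpa_addC : commutative lpa_add.
Proof.
by move=> a b; rewrite -(cls_repr a) -(cls_repr b) !lpaE; exact/clsP/LaddC.
Qed.

Lemma lpa_add0 : left_id (cls Zero) lpa_add.
Proof. by move=> a; rewrite -(cls_repr a) !lpaE; exact/clsP/Ladd0. Qed.

Lemma lpa_addN : left_inverse (cls Zero) lpa_opp lpa_add.
Proof. by move=> a; rewrite -(cls_repr a) !lpaE; exact/clsP/LaddN. Qed.

HB.instance Definition _ :=
  GRing.isZmodule.Build lpa lpa_addA lpa_addC lpa_add0 lpa_addN.

Lemma lpa_scaleA a b (x : lpa) :
  lpa_scale a (lpa_scale b x) = lpa_scale (a * b) x.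
Proof. by rewrite -(cls_repr x) !lpaE; exact/clsP/LscaleA. Qed.

Lemma lpa_scale1 : left_id 1 lpa_scale.
Proof. by move=> x; rewrite -(cls_repr x) !lpaE; exact/clsP/Lscale1. Qed.

Lemma lpa_scaleDr : right_distributive lpa_scale +%R.
Proof.
move=> a x y; rewrite -(cls_repr x) -(cls_repr y) /GRing.add /= !lpaE.
exact/clsP/LscaleDr.
Qed.

Lemma lpa_scaleDl (x : lpa) : {morph lpa_scale^~ x : a b / a + b}.
Proof.
move=> a b; rewrite -(cls_repr x) /= !lpaE [RHS]lpa_addE.
exact/clsP/LscaleDl.
Qed.

HB.instance Definition _ := GRing.Zmodule_isLmodule.Build K lpa
  lpa_scaleA lpa_scale1 lpa_scaleDr lpa_scaleDl.

Lemma lpa_mulA : associative lpa_mul.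
Proof.
move=> a b c; rewrite -(cls_repr a) -(cls_repr b) -(cls_repr c) !lpaE.
exact/clsP/LmulA.
Qed.

Lemma lpa_mulDl : left_distributive lpa_mul +%R.
Proof.
move=> a b c; rewrite -(cls_repr a) -(cls_repr b) -(cls_repr c).
rewrite /GRing.add /= !lpaE.
exact/clsP/LmulDl.
Qed.

Lemma lpa_mulDr : right_distributive lpa_mul +%R.
Proof.
move=> a b c; rewrite -(cls_repr a) -(cls_repr b) -(cls_repr c).
rewrite /GRing.add /= !lpaE.
exact/clsP/LmulDr.
Qed.

HB.instance Definition _ :=
  Zmodule_isRng.Build lpa lpa_mulA lpa_mulDl lpa_mulDr.

Lemma lpa_scaleMl k (x y : lpa) : k *: (x ** y) = (k *: x) ** y.
Proof.
rewrite -(cls_repr x) -(cls_repr y) /GRing.scale /rmul /= !lpaE.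
exact/clsP/LscaleMl.
Qed.

Lemma lpa_scaleMr k (x y : lpa) : k *: (x ** y) = x ** (k *: y).
Proof.
rewrite -(cls_repr x) -(cls_repr y) /GRing.scale /rmul /= !lpaE.
exact/clsP/LscaleMr.
Qed.

HB.instance Definition _ :=
  isNonUnitalAlgebra.Build K lpa lpa_scaleMl lpa_scaleMr.

(* lpa_family and lpa_universal below: lpa is the K-algebra presented by these
   generators and relations. *)
Record leavitt_family (A : nualgType K) (p : vertex E -> A)
    (x y : edge E -> A) : Prop := LeavittFamily {
  lf_idem : forall v, p v ** p v = p v;
  lf_orth : forall v w, v <> w -> p v ** p w = 0;
  lf_source : forall e, p (source e) ** x e = x e;
  lf_range : forall e, x e ** p (range e) = x e;
  lf_rangeG : forall e, p (range e) ** y e = y e;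
  lf_sourceG : forall e, y e ** p (source e) = y e;
  lf_CK1 : forall e, y e ** x e = p (range e);
  lf_CK1o : forall e f, e <> f -> y e ** x f = 0;
  lf_CK2 : forall v es, regular v -> enumerates v es ->
    p v = \sum_(e <- es) x e ** y e
}.

Lemma cls_sum (I : Type) (r : seq I) (F : I -> term) :
  cls (\big[Add/Zero]_(i <- r) F i) = \sum_(i <- r) cls (F i).
Proof.
elim: r => [|i r IH]; first by rewrite !big_nil.
by rewrite !big_cons -IH [RHS]lpa_addE.
Qed.

Lemma lpa_family :
  leavitt_family (A := lpa) (fun v => cls (Vertex v))
    (fun e => cls (Edge e)) (fun e => cls (Ghost e)).
Proof.
have mE (a b : term) : cls a ** cls b = cls (Mul a b) by exact: lpa_mulE.
split=> [v|v w vw|e|e|e|e|e|e f ef|v es rv es_v]; rewrite ?mE.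
- exact/clsP/Lidem.
- exact/clsP/Lorth.
- exact/clsP/Lsource.
- exact/clsP/Lrange.
- exact/clsP/LrangeG.
- exact/clsP/LsourceG.
- exact/clsP/LCK1.
- exact/clsP/LCK1o.
- under eq_bigr do rewrite mE.
  by rewrite -cls_sum; apply/clsP; exact: LCK2.
Qed.

Section Universal.
Variables (A : nualgType K) (p : vertex E -> A) (x y : edge E -> A).
Hypothesis pxy : leavitt_family p x y.

Fixpoint eval (t : term) : A :=
  match t with
  | Vertex v => p v
  | Edge e => x e
  | Ghost e => y e
  | Zero => 0
  | Opp t => - eval t
  | Add t u => eval t + eval u
  | Scale k t => k *: eval t
  | Mul t u => eval t ** eval u
  end.

Lemma eval_sum (I : Type) (r : seq I) (F : I -> term) :
  eval (\big[Add/Zero]_(i <- r) F i) = \sum_(i <- r) eval (F i).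
Proof. by elim: r => [|i r IH]; rewrite ?big_nil// !big_cons/= IH. Qed.

Lemma eval_eq t u : lpa_eq t u -> eval t = eval u.
Proof.
elim=> //=.
- by move=> {}t {}u w _ -> _ ->.
- by move=> {}t {}u _ ->.
- by move=> ? ? ? ? _ -> _ ->.
- by move=> ? ? ? _ ->.
- by move=> ? ? ? ? _ -> _ ->.
- by move=> *; rewrite addrA.
- by move=> *; rewrite addrC.
- by move=> *; rewrite add0r.
- by move=> *; rewrite addNr.
- by move=> *; rewrite scalerA.
- by move=> *; rewrite scale1r.
- by move=> *; rewrite scalerDr.
- by move=> *; rewrite scalerDl.
- by move=> *; rewrite rmulA.
- by move=> *; rewrite rmulDl.
- by move=> *; rewrite rmulDr.
- by move=> *; rewrite scale_rmull.
- by move=> *; rewrite scale_rmulr.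
- by move=> *; rewrite (lf_idem pxy).
- by move=> *; rewrite (lf_orth pxy).
- by move=> *; rewrite (lf_source pxy).
- by move=> *; rewrite (lf_range pxy).
- by move=> *; rewrite (lf_rangeG pxy).
- by move=> *; rewrite (lf_sourceG pxy).
- by move=> *; rewrite (lf_CK1 pxy).
- by move=> *; rewrite (lf_CK1o pxy).
- by move=> v es rv es_v; rewrite eval_sum; exact: (lf_CK2 pxy).
Qed.

Definition is_lpa_lift (f : {linear lpa -> A}) : Prop :=
  [/\ forall a b : lpa, f (a ** b) = f a ** f b,
      forall v, f (cls (Vertex v)) = p v,
      forall e, f (cls (Edge e)) = x e
    & forall e, f (cls (Ghost e)) = y e].

Definition lpa_lift (a : lpa) : A := eval (repr a).

Lemma lpa_liftE t : lpa_lift (cls t) = eval t.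
Proof. exact/eval_eq/repr_cls. Qed.

Lemma lpa_lift_linear : linear lpa_lift.
Proof.
move=> k a b; rewrite -(cls_repr a) -(cls_repr b).
have -> : k *: cls (repr a) + cls (repr b)
    = cls (Add (Scale k (repr a)) (repr b)).
  by rewrite -lpa_addE -lpa_scaleE.
by rewrite !lpa_liftE.
Qed.

HB.instance Definition _ :=
  GRing.isLinear.Build K lpa A *:%R lpa_lift lpa_lift_linear.

Lemma lpa_universal : exists f : {linear lpa -> A},
  is_lpa_lift f /\ forall g : {linear lpa -> A}, is_lpa_lift g -> g =1 f.
Proof.
exists lpa_lift; split.
  by split=> [a b|v|e|e] /=; rewrite lpa_liftE.
move=> g [gM gv ge gG] a; rewrite -(cls_repr a) /= lpa_liftE.
elim: (repr a) => //= [|t IH|t IHt u IHu|k t IH|t IHt u IHu].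
- exact: (raddf0 g).
- by rewrite -IH -raddfN; congr (g _); rewrite -lpa_oppE.
- by rewrite -IHt -IHu -raddfD; congr (g _); rewrite -lpa_addE.
- by rewrite -IH -linearZ; congr (g _); rewrite -lpa_scaleE.
- by rewrite -IHt -IHu -gM; congr (g _); rewrite -lpa_mulE.
Qed.

End Universal.

End LeavittPathAlgebra.

(* Main.v *)
(* Let w = c^oo for a cycle c starting with the edge e0.  For each nonzero scalar
   k, twist the Chen module of w, the space with basis the infinite paths
   tail-equivalent to w, by letting e0 act with the additional factor k and
   e0^* with the factor k^-1.  The module is simple: ghost edges strip long
   initial segments and so isolate a single path in the support of a nonzero
   vector.  The cycle c acts on w as multiplication by k, and the only
   eigenvectors of c for nonzero eigenvalues are the multiples of w, so k is
   an isomorphism invariant.  Hence there are at least |K \ {0}| isomorphism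
   classes of simple modules. *)
Require Import Defs.
From HB Require Import structures.
From mathcomp Require Import all_boot all_algebra.
From mathcomp Require Import boolp classical_sets cardinality.
From mathcomp Require Import functions.

Set Implicit Arguments.
Unset Strict Implicit.
Unset Printing Implicit Defensive.

Import GRing.Theory.

Local Open Scope classical_set_scope.

(** * Infinite paths, their shifts and prepended edges *)

Section InfinitePaths.
Context {E : digraph}.
Implicit Types (e : edge E) (q : nat -> edge E) (i m n : nat).
Local Open Scope nat_scope.

Definition ipath q := forall i, Defs.range (q i) = source (q i.+1).

Definition shift n q : nat -> edge E := fun i => q (n + i).

Definition econs e q : nat -> edge E := fun i => if i is j.+1 then q j else e.

Lemma shift0 q : shift 0 q = q. Proof. by []. Qed.

Lemma shiftD m n q : shift m (shift n q) = shift (n + m) q.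
Proof. by apply/funext => i; rewrite /shift addnA. Qed.

Lemma shift_econs e q : shift 1 (econs e q) = q.
Proof. exact/funext. Qed.

Lemma econs_shift q : econs (q 0) (shift 1 q) = q.
Proof. by apply/funext => -[]. Qed.

Lemma ipath_shift n q : ipath q -> ipath (shift n q).
Proof. by move=> qP i; rewrite /shift addnS. Qed.

Lemma ipath_econs e q :
  ipath (econs e q) <-> ipath q /\ Defs.range e = source (q 0).
Proof.
split=> [qP|[qP eq] [|i]] //=.
by split; [move=> i; exact: (qP i.+1)|exact: (qP 0)].
Qed.

End InfinitePaths.

(** * The twisted action and the Leavitt relations *)

Section TwistedAction.
Context {K : fieldType} {E : digraph}.
Variable (a : edge E -> K).
Hypothesis a_neq0 : forall e, a e != 0%R.
Implicit Types (t u : term K E) (q : nat -> edge E) (g h : (nat -> edge E) -> K).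
Local Open Scope ring_scope.

(* Functions on all sequences of edges, not only on infinite paths: the relations
   of the Leavitt path algebra, including CK2, hold because the generators
   vanish off the infinite paths. *)
Fixpoint tact t g {struct t} : (nat -> edge E) -> K :=
  match t with
  | Vertex v => fun q => if `[< ipath q /\ source (q 0) = v >] then g q else 0
  | Edge e => fun q =>
      if `[< ipath q /\ q 0 = e >] then a e * g (shift 1 q) else 0
  | Ghost e => fun q =>
      if `[< ipath (econs e q) >] then (a e)^-1 * g (econs e q) else 0
  | Zero => fun=> 0
  | Opp t => fun q => - tact t g q
  | Add t u => fun q => tact t g q + tact u g q
  | Scale k t => fun q => k * tact t g q
  | Mul t u => tact t (tact u g)
  end.

Lemma tact0 t q : tact t (fun=> 0) q = 0.
Proof.
elim: t q => //= [v|e|e|t IH|t IHt u IHu|k t IH|t IHt u IHu] q.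
- by case: ifP.
- by rewrite mulr0 if_same.
- by rewrite mulr0 if_same.
- by rewrite IH oppr0.
- by rewrite IHt IHu addr0.
- by rewrite IH mulr0.
- by rewrite (_ : tact u _ = fun=> 0) //; exact/funext.
Qed.

Lemma tactD t g h q :
  tact t (fun p => g p + h p) q = tact t g q + tact t h q.
Proof.
elim: t g h q => //= [v|e|e||t IH|t IHt u IHu|k t IH|t IHt u IHu] g h q.
- by case: ifP; rewrite ?addr0.
- by case: ifP; rewrite ?addr0 ?mulrDr.
- by case: ifP; rewrite ?addr0 ?mulrDr.
- by rewrite addr0.
- by rewrite IH opprD.
- by rewrite IHt IHu addrACA.
- by rewrite IH mulrDr.
- by rewrite -IHt; congr (tact t _ q); exact/funext.
Qed.

Lemma tactZ t k g q : tact t (fun p => k * g p) q = k * tact t g q.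
Proof.
elim: t g q => //= [v|e|e||t IH|t IHt u IHu|l t IH|t IHt u IHu] g q.
- by case: ifP; rewrite ?mulr0.
- by case: ifP; rewrite ?mulr0 // mulrCA.
- by case: ifP; rewrite ?mulr0 // mulrCA.
- by rewrite mulr0.
- by rewrite IH mulrN.
- by rewrite IHt IHu mulrDr.
- by rewrite IH mulrCA.
- by rewrite -IHt; congr (tact t _ q); exact/funext.
Qed.

Lemma tact_sum (I : Type) (r : seq I) (F : I -> term K E) g q :
  tact (\big[@Add K E/Zero K E]_(i <- r) F i) g q = \sum_(i <- r) tact (F i) g q.
Proof. by elim: r => [|i r IH]; rewrite ?big_nil// !big_cons/= IH. Qed.

Lemma tact_edge_ghost e g q :
  tact (Mul (Edge K e) (Ghost K e)) g q =
  if `[< ipath q /\ q 0 = e >] then g q else 0.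
Proof.
rewrite /=; case: asboolP => // -[qP <-]; rewrite econs_shift asboolT//.
by rewrite mulrA divff// mul1r.
Qed.

(** Serves CK2, where e is the first edge of a path: in a repetition-free list it contributes at
    most once. *)
Lemma big_edge_eq (P : Prop) (es : seq (edge E)) e (k : K) :
  List.NoDup es ->
  \sum_(f <- es) (if `[< P /\ e = f >] then k else 0) =
  if `[< P /\ List.In e es >] then k else 0.
Proof.
elim: es => [_|f es IH /List.NoDup_cons_iff[fes /IH{}IH]].
  by rewrite big_nil asboolF// => -[].
rewrite big_cons IH; case: asboolP => [[p ef]|nef].
  rewrite -ef in fes *; rewrite asboolF ?asboolT ?addr0//; last by case.
  by split=> //; left.
rewrite add0r; congr (if _ then _ else _); apply: asbool_equiv_eq.
split=> -[p]; first by move=> ?; split=> //; right.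
by case=> [fe|//]; case: nef.
Qed.

(** Induction on the congruence. The weights [a e] and their inverses cancel in CK1 and CK2, so
    every nonvanishing [a] gives an action. *)
Lemma tact_eq t u : lpa_eq t u -> tact t = tact u.
Proof.
elim=> //=.
- by move=> {}t {}u w _ -> _ ->.
- by move=> {}t {}u _ ->.
- by move=> ? ? ? ? _ -> _ ->.
- by move=> ? ? ? _ ->.
- by move=> ? ? ? ? _ -> _ ->.
- by move=> *; apply/funext => g; apply/funext => q; rewrite addrA.
- by move=> *; apply/funext => g; apply/funext => q; rewrite addrC.
- by move=> *; apply/funext => g; apply/funext => q; rewrite add0r.
- by move=> *; apply/funext => g; apply/funext => q; rewrite addNr.
- by move=> *; apply/funext => g; apply/funext => q; rewrite mulrA.
- by move=> *; apply/funext => g; apply/funext => q; rewrite mul1r.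
- by move=> *; apply/funext => g; apply/funext => q; rewrite mulrDr.
- by move=> *; apply/funext => g; apply/funext => q; rewrite mulrDl.
- by move=> *; apply/funext => g; apply/funext => q; rewrite tactD.
- by move=> *; apply/funext => g; apply/funext => q; rewrite tactZ.
- move=> v; apply/funext => g; apply/funext => q.
  by case: asboolP => // ?; rewrite asboolT.
- move=> v w vw; apply/funext => g; apply/funext => q.
  case: asboolP => // -[_ qv]; case: asboolP => // -[_ qw].
  by case: vw; rewrite -qv.
- move=> e; apply/funext => g; apply/funext => q.
  case: (asboolP (_ /\ _ = e)) => [[qP <-]|]; first by rewrite asboolT.
  by rewrite if_same.
- move=> e; apply/funext => g; apply/funext => q.
  case: asboolP => // -[qP <-]; rewrite asboolT//; split.
    exact: ipath_shift.
  by rewrite qP.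
- move=> e; apply/funext => g; apply/funext => q.
  case: (asboolP (ipath (econs e q))) => [/ipath_econs[qP eq]|]; last first.
    by rewrite if_same.
  by rewrite asboolT.
- move=> e; apply/funext => g; apply/funext => q.
  by case: asboolP => // ?; rewrite asboolT.
- move=> e; apply/funext => g; apply/funext => q.
  case: asboolP => [eqP|neqP].
    rewrite asboolT// shift_econs mulrA mulVf// mul1r asboolT//.
    by case/ipath_econs: eqP.
  rewrite asboolF// => -[qP eq]; apply: neqP; exact/ipath_econs.
- move=> e f ef; apply/funext => g; apply/funext => q.
  by case: asboolP => // _; rewrite asboolF ?mulr0// => -[_ /ef].
- move=> v es _ [uniq_es es_v]; apply/funext => g; apply/funext => q.
  rewrite tact_sum (eq_bigr (fun e =>
    if `[< ipath q /\ q 0 = e >] then g q else 0)); last first.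
    by move=> e _; rewrite tact_edge_ghost.
  rewrite big_edge_eq//; congr (if _ then _ else _).
  by apply: asbool_equiv_eq; split=> -[qP qv]; split=> //; apply/es_v.
Qed.

(** * Finite support in a tail-equivalence class *)

(** For periodic w, tail equivalence to w amounts to having w itself as a shift. *)
Definition tail_supported w g :=
  finite_set [set q | g q != 0] /\
  forall q, g q != 0 -> ipath q /\ exists m, shift m q = w.

(** The support of h lies in the image under F of that of g, hence is finite. F is the identity for
    vertices, [econs e] for edges and [shift 1] for ghost edges. *)
Lemma tail_supportedS w g h (F : (nat -> edge E) -> nat -> edge E) :
    (forall q, h q != 0 -> ipath q /\ exists p, [/\ g p != 0, q = F p
      & forall m, shift m p = w -> exists m', shift m' q = w]) ->
  tail_supported w g -> tail_supported w h.
Proof.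
move=> hF [fin_g tl_g]; split.
  apply: sub_finite_set (finite_image F fin_g) => q /= /hF[_ [p [gp -> _]]].
  by exists p.
move=> q /hF[qP [p [/tl_g[_ [m pm]] _ /(_ m pm)]]] //.
Qed.

Lemma tail_supportedD w g h : tail_supported w g -> tail_supported w h ->
  tail_supported w (fun q => g q + h q).
Proof.
move=> [fin_g tl_g] [fin_h tl_h].
have gh q : g q + h q != 0 -> g q != 0 \/ h q != 0.
  case: (eqVneq (g q) 0) => [->|]; last by left.
  by rewrite add0r; right.
split; last by move=> q /gh[/tl_g|/tl_h].
apply: (@sub_finite_set _ _ ([set q | g q != 0] `|` [set q | h q != 0])) => //=.
by rewrite finite_setU.
Qed.

Definition delta w : (nat -> edge E) -> K :=
  fun q => if `[< q = w >] then 1 else 0.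

Lemma delta_neq0 w q : delta w q != 0 -> q = w.
Proof. by rewrite /delta; case: asboolP => // _; rewrite eqxx. Qed.

Lemma tail_supported_delta w : ipath w -> tail_supported w (delta w).
Proof.
move=> wP; split; last by move=> q /delta_neq0->; split=> //; exists 0.
apply: sub_finite_set (finite_set1 w); exact: delta_neq0.
Qed.

(** * Carrying vectors to the basis vector of a periodic path *)

Section PeriodicPath.
Variables (w : nat -> edge E) (n : nat).
Hypotheses (wP : ipath w) (n_gt0 : (0 < n)%N) (w_per : shift n w = w).

Lemma shift_period k : shift (k * n) w = w.
Proof. by elim: k => // k IH; rewrite mulSn -shiftD w_per. Qed.

Lemma tact_tail_supported t g : tail_supported w g -> tail_supported w (tact t g).
Proof.
have S0 : tail_supported w (fun=> 0).
  split=> [|q]; last by rewrite eqxx.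
  by apply: (sub_finite_set _ (finite_set0 (nat -> edge E))) => q /=; rewrite eqxx.
elim: t g => //= [v|e|e|t IH|t IHt u IHu|k t IH|t IHt u IHu] g gS.
- apply: tail_supportedS id _ gS => q.
  case: asboolP => [[qP _] gq|]; last by rewrite eqxx.
  by split=> //; exists q; split=> // m qm; exists m.
- apply: tail_supportedS (econs e) _ gS => q.
  case: asboolP => [[qP <-]|]; last by rewrite eqxx.
  rewrite mulf_eq0 negb_or => /andP[_ gq]; split=> //.
  exists (shift 1 q); split=> //; first by rewrite econs_shift.
  by move=> m; rewrite shiftD => qm; exists (1 + m)%N.
- apply: tail_supportedS (shift 1) _ gS => q.
  case: asboolP => [/ipath_econs[qP _]|]; last by rewrite eqxx.
  rewrite mulf_eq0 negb_or => /andP[_ gq]; split=> //.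
  exists (econs e q); split=> //.
  (* For m = 0 the removed edge already belongs to w, so one more turn around the period is made: 1
     + (m + n.-1) = m + n. *)
  move=> m qm; exists (m + n.-1)%N; rewrite -[q in LHS](shift_econs e) shiftD.
  by rewrite addnCA add1n prednK// -shiftD qm.
- apply: tail_supportedS id _ (IH g gS) => q; rewrite oppr_eq0 => gq.
  case: (IH g gS) => _ /(_ q gq)[qP _].
  by split=> //; exists q; split=> // m qm; exists m.
- by apply: tail_supportedD; [exact: IHt|exact: IHu].
- apply: tail_supportedS id _ (IH g gS) => q.
  rewrite mulf_eq0 negb_or => /andP[_ gq].
  case: (IH g gS) => _ /(_ q gq)[qP _].
  by split=> //; exists q; split=> // m qm; exists m.
- exact/IHt/IHu.
Qed.

(** Each p other than q differs from q at some index [d p]; a prefix reaching past these finitely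
    many indices separates. *)
Lemma separating_prefix q (A : set (nat -> edge E)) : finite_set A ->
  exists m, forall p, A p -> (forall i, (i < m)%N -> p i = q i) -> p = q.
Proof.
move=> finA.
have /choice[d dP] p : exists i, p <> q -> p i <> q i.
  have [->|pq] := pselect (p = q); first by exists 0.
  have : ~ forall i, p i = q i by move=> h; apply: pq; exact/funext.
  by move=> /existsNP[i]; exists i.
have /finite_seqP[s sP] := finite_image d finA.
exists (\max_(i <- s) i).+1 => p Ap pq; apply: contrapT => /[dup] npq /dP; apply.
apply: pq; rewrite ltnS; apply: (@leq_bigmax_seq _ s xpredT id) => //.
have : (d @` A) (d p) by exists p.
by rewrite sP.
Qed.

(** Induction on m: the ghost of the first edge of q kills the paths starting otherwise and shortens
    the rest, so a prefix of length m - 1 separates afterwards. *)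
Lemma tact_isolate m q g : ipath q -> shift m q = w -> g q != 0 ->
    (forall p, g p != 0 -> (forall i, (i < m)%N -> p i = q i) -> p = q) ->
  exists t k, k != 0 /\ tact t g = (fun p => k * delta w p).
Proof.
elim: m q g => [|m IH] q g qP qw gq sep.
  (* The empty prefix separates, so g is supported on q = w alone and the vertex fixes it. *)
  exists (Vertex K (source (w 0))), (g q); split=> //; apply/funext => p /=.
  rewrite shift0 in qw; rewrite -qw /delta.
  case: (asboolP (p = q)) => [->|pq]; first by rewrite asboolT ?mulr1.
  rewrite mulr0; case: ifP => // _; apply/eqP; apply: contrapT => /negP gp.
  exact/pq/sep.
have [||||t [k [k0 tE]]] := IH (shift 1 q) (tact (Ghost K (q 0)) g).
- exact: ipath_shift.
- by rewrite shiftD.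
- by rewrite /= econs_shift asboolT// mulf_neq0// invr_eq0.
- move=> p /=; case: asboolP => [pP|]; last by rewrite eqxx.
  rewrite mulf_eq0 negb_or => /andP[_ gp] pq.
  rewrite -(shift_econs (q 0) p); congr shift; apply: sep => // -[|i]//= im.
  exact: pq.
by exists (Mul t (Ghost K (q 0))), k; split.
Qed.

(* A support-separating initial segment of q, extended to reach the periodic
   part, is removed by ghost edges. *)
Lemma tact_to_delta g : tail_supported w g -> (exists q, g q != 0) ->
  exists t, tact t g = delta w.
Proof.
move=> [fin_g tl_g] [q gq]; have [qP [m0 qm0]] := tl_g _ gq.
have [m1 sep] := @separating_prefix q _ fin_g.
(* Adding a multiple of n to m0 still shifts q to w, and n > 0 gives m1 <= m1 * n. *)
have [|||p gp pq|t [k [k0 tE]]] := @tact_isolate (m0 + m1 * n)%N q g.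
- by [].
- by rewrite -shiftD qm0 shift_period.
- by [].
- apply: sep => // i im1; apply: pq; apply: leq_trans im1 _.
  by apply: (leq_trans (leq_pmulr _ n_gt0)); exact: leq_addl.
by exists (Scale k^-1 t); apply/funext => p /=; rewrite tE mulrA mulVf// mul1r.
Qed.

(** * The Chen module and its simplicity *)

(** Taking the submodule generated by [delta w] makes stability under the action immediate and
    reduces simplicity to reaching [delta w]. *)
Definition in_cyclic g := `[< exists t, g = tact t (delta w) >].

Fact in_cyclic_zmod_closed : zmod_closed in_cyclic.
Proof.
split; first by apply/asboolP; exists (Zero K E).
move=> _ _ /asboolP[t ->] /asboolP[u ->].
by apply/asboolP; exists (Add t (Opp u)).
Qed.

HB.instance Definition _ :=
  GRing.isZmodClosed.Build _ in_cyclic in_cyclic_zmod_closed.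

Record cyclic_space := CyclicSpace {
  cval : (nat -> edge E) -> K;
  cvalP : in_cyclic cval
}.

HB.instance Definition _ := [isSub for cval].
HB.instance Definition _ := [Choice of cyclic_space by <:].
HB.instance Definition _ := [SubChoice_isSubZmodule of cyclic_space by <:].

Lemma tact_base_vertex : tact (Vertex K (source (w 0))) (delta w) = delta w.
Proof.
apply/funext => q /=; case: asboolP => // nq.
apply/esym/eqP; apply: contrapT => /negP/delta_neq0 qw.
by apply: nq; rewrite qw.
Qed.

Lemma delta_cyclic : in_cyclic (delta w).
Proof.
by apply/asboolP; exists (Vertex K (source (w 0))); rewrite tact_base_vertex.
Qed.

Lemma tact_cyclic t g : in_cyclic g -> in_cyclic (tact t g).
Proof. by move=> /asboolP[u ->]; apply/asboolP; exists (Mul t u). Qed.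

Definition cyclic_act (r : lpa K E) (x : cyclic_space) : cyclic_space :=
  CyclicSpace (tact_cyclic (repr r) (cvalP x)).

(** The action does not depend on the representative, by [tact_eq]. *)
Lemma cval_act t x : cval (cyclic_act (cls t) x) = tact t (cval x).
Proof. by rewrite /= (tact_eq (repr_cls t)). Qed.

Fact cyclic_act_addr r x y :
  cyclic_act r (x + y) = cyclic_act r x + cyclic_act r y.
Proof. by apply: val_inj; apply/funext => q; exact: tactD. Qed.

Fact cyclic_act_addl r s x :
  cyclic_act (r + s) x = cyclic_act r x + cyclic_act s x.
Proof.
(* In the quotient, [r + s] unfolds to the class of this [Add] of representatives. *)
by apply: val_inj; rewrite [LHS](cval_act (Add (repr r) (repr s))).
Qed.

Fact cyclic_act_mul (r s : lpa K E) x :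
  cyclic_act (r ** s) x = cyclic_act r (cyclic_act s x).
Proof.
by apply: val_inj; rewrite [LHS](cval_act (Mul (repr r) (repr s))).
Qed.

Definition chen_module : leftModule (lpa K E) :=
  LeftModule cyclic_act_addr cyclic_act_addl cyclic_act_mul.

Lemma chen_module_eq (x y : chen_module) : cval x = cval y -> x = y.
Proof. exact: val_inj. Qed.

Lemma act_cls t (x : chen_module) : cval (act (cls t) x) = tact t (cval x).
Proof. exact: cval_act. Qed.

Definition base_vector : chen_module := CyclicSpace delta_cyclic.

Lemma base_vector_neq0 : base_vector <> 0.
Proof.
move=> /(congr1 cval)/(congr1 (fun g => g w)) /=.
rewrite /delta asboolT// => /eqP; apply/negP; exact: oner_neq0.
Qed.

Lemma act_base_vertex :
  act (cls (Vertex K (source (w 0)))) base_vector = base_vector.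
Proof. by apply: chen_module_eq; rewrite act_cls; exact: tact_base_vertex. Qed.

(** A nonzero vector of a submodule is carried to [delta w], which generates the whole module. *)
Lemma chen_module_simple : is_simple chen_module.
Proof.
split.
  exists (cls (Vertex K (source (w 0)))), base_vector.
  by rewrite act_base_vertex; exact: base_vector_neq0.
move=> N [N0 _ _ Nact]; have [[x [Nx x0]]|nex] := pselect (exists x, N x /\ x <> 0).
- right; have [||t tx] := @tact_to_delta (cval x).
  + have /asboolP[u ->] := cvalP x.
    by apply: tact_tail_supported; exact: tail_supported_delta.
  + apply: contrapT => /forallNP gx; apply: x0; apply: chen_module_eq.
    by apply/funext => q; have /negP := gx q; rewrite negbK => /eqP.
  apply/seteqP; split=> // y _; have /asboolP[u uy] := cvalP y.
  rewrite (_ : y = act (cls u) (act (cls t) x)); first exact/Nact/Nact.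
  by apply: chen_module_eq; rewrite [RHS]act_cls act_cls tx.
- left; apply/seteqP; split=> x /=; last by move->.
  by move=> Nx; apply: contrapT => x0; apply: nex; exists x.
Qed.

End PeriodicPath.

(** * Eigenvectors of the cycle *)

(** The final vertex gives a meaning to length zero in an algebra without unit. For w and its period
    this is the cycle c. *)
Fixpoint initial_segment m q : term K E :=
  if m is m'.+1 then Mul (Edge K (q 0)) (initial_segment m' (shift 1 q))
  else Vertex K (source (q 0)).

Lemma tact_initial_segment m q g p : tact (initial_segment m q) g p =
  if `[< [/\ ipath p, forall i, (i < m)%N -> p i = q i
           & source (p m) = source (q m)] >]
  then \prod_(i < m) a (q i) * g (shift m p) else 0.
Proof.
elim: m q p => [|m IH] q p /=.
  rewrite big_ord0 mul1r; congr (if _ then _ else _).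
  by apply: asbool_equiv_eq; split=> [[]|[]].
case: asboolP => [[pP p0]|np]; last first.
  by rewrite asboolF// => -[pP pq _]; apply: np; split=> //; exact: pq.
rewrite IH big_ord_recl shiftD; case: asboolP => [[_ pq pqm]|np].
  rewrite asboolT ?mulrA//; split=> // -[|i]//; exact: pq.
rewrite mulr0 asboolF// => -[_ pq pqm]; apply: np; split=> //.
  exact: ipath_shift.
by move=> i im; exact: (pq i.+1).
Qed.

Lemma tact_period_delta w n : ipath w -> shift n w = w ->
  tact (initial_segment n w) (delta w) =
  (fun p => \prod_(i < n) a (w i) * delta w p).
Proof.
move=> wP w_per; apply/funext => p; rewrite tact_initial_segment.
case: asboolP => [[pP pw _]|np]; last first.
  rewrite /delta; case: asboolP => [pw|]; last by rewrite mulr0.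
  by case: np; rewrite pw.
congr (_ * _); rewrite /delta; congr (if _ then _ else _).
apply: asbool_equiv_eq; split=> [npw|->//].
apply/funext => i; have [/pw//|ni] := ltnP i n.
(* Past index n, p continues as w from its start, and periodicity realigns the indices. *)
by rewrite -(subnKC ni) -[LHS]/(shift n p _) npw -[RHS]/(shift n w _) w_per.
Qed.

(* An eigenvector for a nonzero eigenvalue is supported on w alone, since each
   application moves p to p with its initial segment w_0 ... w_(n-1) removed. *)
Lemma period_eigenvalue w n k g : (0 < n)%N -> ipath w -> shift n w = w ->
    k != 0 -> (exists q, g q != 0) ->
    tact (initial_segment n w) g = (fun p => k * g p) ->
  k = \prod_(i < n) a (w i).
Proof.
move=> n_gt0 wP w_per k0 [q gq] eig.
have step p : g p != 0 -> (forall i, (i < n)%N -> p i = w i) /\ g (shift n p) != 0.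
  move=> gp; have := congr1 (fun f => f p) eig.
  rewrite tact_initial_segment; case: asboolP => [[_ pw _] eq|_ /esym/eqP].
    split=> //; have : k * g p != 0 by rewrite mulf_neq0.
    by rewrite -eq mulf_eq0 negb_or => /andP[].
  by rewrite mulf_eq0 (negbTE k0) (negbTE gp).
have prefix j : forall p, g p != 0 -> forall i, (i < j * n)%N -> p i = w i.
  elim: j => // j IH p /step[pw /IH pj] i ij.
  have [/pw//|ni] := ltnP i n.
  rewrite -(subnKC ni) -[LHS]/(shift n p _) pj; last by rewrite ltn_subLR.
  by rewrite -[RHS]/(shift n w _) w_per.
have qw : q = w.
  apply/funext => i; apply: (prefix i.+1) => //.
  by rewrite (leq_trans _ (leq_pmulr _ n_gt0)).
rewrite qw in gq; have := congr1 (fun f => f w) eig.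
rewrite tact_initial_segment asboolT//= w_per => /esym/eqP.
by rewrite -subr_eq0 -mulrBl mulf_eq0 (negbTE gq) orbF subr_eq0 => /eqP.
Qed.

End TwistedAction.

(** * From the isomorphism invariant to countability *)

Arguments cval {K E a w}.

Lemma chen_module_iso_prod (K : fieldType) (E : digraph) (a b : edge E -> K)
    (a0 : forall e, (a e != 0)%R) (b0 : forall e, (b e != 0)%R)
    (w : nat -> edge E) (n : nat) : (0 < n)%N -> ipath w -> shift n w = w ->
    module_iso (chen_module a0 w) (chen_module b0 w) ->
  (\prod_(i < n) a (w i) = \prod_(i < n) b (w i))%R.
Proof.
move=> n_gt0 wP w_per [f [f_bij f_act]].
pose d := base_vector a0 wP.
have fd_vertex : act (cls (Vertex K (source (w 0)))) (f d) = f d.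
  by rewrite -f_act act_base_vertex.
(* The isomorphism f is only known to be additive and compatible with the algebra, so the scalar is
   written as a multiple of the base vertex, which fixes both d and [f d]. *)
have d_eig : act (cls (initial_segment n w)) d =
    act (cls (Scale (\prod_(i < n) a (w i))%R (Vertex K (source (w 0))))) d.
  apply: chen_module_eq; rewrite [LHS]act_cls [RHS]act_cls tact_period_delta//.
  by apply/funext => q; rewrite -[in LHS](tact_base_vertex a wP).
apply: (@period_eigenvalue _ _ b w n _ (cval (f d))) => //.
- by apply/prodf_neq0.
- apply: contrapT => /forallNP fd0; apply: (@base_vector_neq0 _ _ a a0 w wP).
  apply: (bij_inj f_bij); rewrite raddf0; apply: chen_module_eq.
  by apply/funext => q; have /negP := fd0 q; rewrite negbK => /eqP.
- move: (congr1 cval (congr1 f d_eig)); rewrite !f_act [LHS]act_cls [RHS]act_cls /=.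
  move=> ->; apply/funext => q.
  by rewrite -[in RHS]fd_vertex [in RHS]act_cls.
Qed.

(* The guard k != 0 makes the twist nonzero for every k, so that the family of
   modules is indexed by all of K. *)
Definition twist {K : fieldType} {E : digraph} (e0 : edge E) (k : K)
    (e : edge E) : K :=
  if `[< e = e0 >] && (k != 0)%R then k else 1%R.

Lemma twist_neq0 {K : fieldType} {E : digraph} (e0 : edge E) (k : K) e :
  (twist e0 k e != 0)%R.
Proof. by rewrite /twist; case: ifP => [/andP[]//|_]; exact: oner_neq0. Qed.

(** Distinct sources make e0 occur once per period, so the weights of a period multiply to k rather
    than to a higher power, which need not determine k. *)
Lemma cycle_unroll (E : digraph) (e0 : edge E) (c : seq (edge E)) :
    is_cycle (e0 :: c) ->
  let w i := nth e0 (e0 :: c) (i %% (size c).+1) in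
  [/\ ipath w, shift (size c).+1 w = w
    & forall i : 'I_(size c), w (lift ord0 i) <> w 0].
Proof.
move=> [[_ c_cyc] /andP[c_e0 _]] w; split.
- move=> i; rewrite /w -[i.+1]addn1 -modnDml addn1.
  have := ltn_pmod i (isT : (0 < (size c).+1)%N); set j := (i %% _)%N => jc.
  have /(pathP e0)/(_ j) := c_cyc; rewrite size_rcons => /(_ jc)/asboolP.
  rewrite -rcons_cons nth_rcons /= jc => ->; rewrite nth_rcons.
  (* At the last index j = [size c] the successor wraps around to e0, which closes the path. *)
  move: jc; rewrite ltnS leq_eqVlt => /orP[/eqP->|jc].
    by rewrite modnn ltnn eqxx.
  by rewrite jc modn_small.
- by apply/funext => i; rewrite /shift /w modnDl.
- move=> i; rewrite /w mod0n modn_small/= ?ltnS// => ei.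
  have /asboolP := all_nthP e0 c_e0 i (ltn_ord i); by rewrite ei.
Qed.

Theorem proposition3p2 (E : digraph) (K : fieldType)
    (hcycle : exists c : seq (edge E), is_cycle c)
    (hCIRT : CIRT (lpa K E)) :
  countable [set: K].
Proof.
have [[|e0 c] c_cycle] := hcycle; first by case: c_cycle => -[].
have [] := cycle_unroll c_cycle; set w := fun i => _ => wP w_per w_neq.
have [f fP] := hCIRT.
pose S (k : K) := chen_module (twist_neq0 e0 k) w.
have prod_twist (k : K) : (k != 0 ->
    \prod_(i < (size c).+1) twist e0 k (w i) = k)%R.
  move=> k0; rewrite big_ord_recl big1 ?mulr1; last first.
    by move=> i _; rewrite /twist asboolF//; exact: w_neq.
  by rewrite /twist asboolT//= k0.
(* The scalar 0 gives no twist of its own; it takes the value 0, and the successor keeps the other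
   values apart from it. *)
apply/countable_injP; exists (fun k : K => if k == 0%R then 0 else (f (S k)).+1).
move=> k l _ _; case: (eqVneq k 0%R) => [->|k0]; case: (eqVneq l 0%R) => [->|l0] // [].
move/fP => kl; rewrite -(prod_twist _ k0) -(prod_twist _ l0).
apply: (chen_module_iso_prod (a0 := twist_neq0 e0 k) (b0 := twist_neq0 e0 l)) => //.
by apply: kl; exact: chen_module_simple wP _ w_per.
Qed.
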